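(* Let $N$ be a positive integer and $n\in\mathbb{N}$. In each of the following four cases the set $\mathrm{TFF}(\alpha,N)$ has exactly one maximal element with respect to the majorization order $\preccurlyeq$, namely the sequence $\mathbf L$ given: (1) $\alpha=n$: $\mathbf L=(N,N,\ldots,N)$ ($n$ entries); (2) $\alpha=1+\frac1n$ and $n\mid N$: $\mathbf L=(\frac Nn,\ldots,\frac Nn)$ ($n+1$ entries); (3) $\alpha=n+\frac12$ and $2\mid N$: $\mathbf L=(N,\ldots,N,\frac N2,\frac N2,\frac N2)$ with $n-1$ entries equal to $N$; (4) $\alpha=1+\frac{2}{2n-1}$ and $(2n-1)\mid N$: $\mathbf L=(\frac{2N}{2n-1},\ldots,\frac{2N}{2n-1},\frac{N}{2n-1},\frac{N}{2n-1},\frac{N}{2n-1})$ with $n-1$ entries equal to $\frac{2N}{2n-1}$.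
   Context: $\mathrm{TFF}(\alpha,N)$ is the set of weakly decreasing sequences of positive integers $(L_1,\ldots,L_K)$ such that there exist orthogonal projections $P_1,\ldots,P_K$ on $\mathbb{R}^N$ with $\operatorname{rank}P_i=L_i$ and $\sum_{i=1}^K P_i=\alpha\mathbf I$. Majorization: $\mathbf L\preccurlyeq\mathbf L'$ iff the total sums are equal and $\sum_{i\le k}L_i\le\sum_{i\le k}L'_i$ for all $k\le\min(K,K')$. *)

(* Defs.v *)
From HB Require Import structures.
From mathcomp Require Import all_boot all_order all_algebra.
From mathcomp Require Import Rstruct.
From Stdlib Require Rdefinitions.
Notation R := Rdefinitions.R.
Set Implicit Arguments. Unset Strict Implicit. Unset Printing Implicit Defensive.
Import Order.TTheory GRing.Theory Num.Theory.
Local Open Scope ring_scope.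

Definition orth_proj (N : nat) (P : 'M[R]_N) : Prop :=
  P^T = P /\ P *m P = P.

Definition TFF (alpha : R) (N : nat) (L : seq nat) : Prop :=
  sorted geq L /\ all (fun l : nat => (0 < l)%N) L /\
  exists P : 'I_(size L) -> 'M[R]_N,
    (forall i, orth_proj (P i)) /\
    (forall i, \rank (P i) = nth 0%N L i) /\
    \sum_(i < size L) P i = alpha%:M.

Definition majorized (L L' : seq nat) : Prop :=
  sumn L = sumn L' /\
  forall k, (k <= minn (size L) (size L'))%N ->
    (sumn (take k L) <= sumn (take k L'))%N.

Definition maximal_elt (S : seq nat -> Prop) (M : seq nat) : Prop :=
  S M /\ forall M', S M' -> majorized M M' -> M' = M.

Definition unique_maximal (S : seq nat -> Prop) (L : seq nat) : Prop :=
  forall M, maximal_elt S M <-> M = L.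

(* Main.v *)
(* A sequence L that belongs to TFF(a, N) and majorizes all of TFF(a, N) is its
   unique maximal element.  Naimark complementation identifies TFF(a, N) with
   TFF(a / (a - 1), (a - 1) N) for a > 1; it turns case (1) into case (2) and
   case (3) into case (4).  Case (1) only uses that ranks are at most N.  In
   case (3), a = n + 1/2, the n-th partial sum is bounded because a - sum_(i<n)
   P_i is positive definite, and the (n+1)-st because n + 1 - sum_(i<n+1) P_i
   is; the extremal sequence is obtained by adding identities to the complement
   of (d, d, d) in TFF(3, d). *)

Require Import Defs.
From HB Require Import structures.
From mathcomp Require Import all_boot all_order all_algebra.
From mathcomp Require Import Rstruct.
From mathcomp Require Import ring lra zify.

Set Implicit Arguments.
Unset Strict Implicit.

Import Order.TTheory GRing.Theory Num.Theory.
Local Open Scope ring_scope.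

(** * Rank, quadratic form and factorization of orthogonal projections *)

(** In the full-rank factorization P = C B, idempotence forces B C to be the identity of size
    [\rank P]; the trace is cyclic. *)
Lemma rank_idempotent (F : fieldType) n (P : 'M[F]_n) :
  P *m P = P -> (\rank P)%:R = \tr P.
Proof.
move=> PP; have RC : row_base P *m col_base P = 1%:M.
  apply: (row_free_inj (row_base_free P)).
  apply: (row_full_inj (col_base_full P)).
  by rewrite /= mul1mx -(mulmxA _ _ (row_base P)) mulmxA mulmx_base PP.
by rewrite -[in RHS](mulmx_base P) mxtrace_mulC RC mxtrace1.
Qed.

Lemma dotmx_ge0 n (v : 'rV[R]_n) : 0 <= (v *m v^T) 0 0.
Proof. by rewrite mxE sumr_ge0 // => i _; rewrite mxE -expr2 sqr_ge0. Qed.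

Lemma dotmx_eq0 n (v : 'rV[R]_n) : (v *m v^T) 0 0 = 0 -> v = 0.
Proof.
rewrite mxE => /eqP; rewrite psumr_eq0 => [/allP h|i _]; last first.
  by rewrite mxE -expr2 sqr_ge0.
apply/rowP => i; move/(_ i (mem_index_enum _)): h.
by rewrite !mxE -expr2 sqrf_eq0 => /eqP.
Qed.

Lemma dotmx_gt0 n (v : 'rV[R]_n) : v != 0 -> 0 < (v *m v^T) 0 0.
Proof.
move=> v0; rewrite lt_def dotmx_ge0 andbT.
by apply: contraNneq v0 => /dotmx_eq0 ->.
Qed.

Lemma orth_projC n (P : 'M[R]_n) : orth_proj P -> orth_proj (1%:M - P).
Proof.
move=> [PT PP]; split; first by rewrite linearB /= trmx1 PT.
by rewrite mulmxBl mul1mx mulmxBr mulmx1 PP subrr subr0.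
Qed.

Lemma orth_proj_rank n (P : 'M[R]_n) : orth_proj P -> (\rank P)%:R = \tr P.
Proof. by case=> _ /rank_idempotent. Qed.

Lemma orth_proj_rankC n (P : 'M[R]_n) :
  orth_proj P -> \rank (1%:M - P) = (n - \rank P)%N.
Proof.
move=> oP; apply/eqP; rewrite -(eqr_nat R) natrB ?rank_leq_row //.
by rewrite !orth_proj_rank ?linearB /= ?mxtrace1 //; apply: orth_projC.
Qed.

Lemma orth_proj_form_ge0 n (P : 'M[R]_n) (v : 'rV_n) :
  orth_proj P -> 0 <= (v *m P *m v^T) 0 0.
Proof.
move=> [PT PP]; suff -> : v *m P *m v^T = (v *m P) *m (v *m P)^T.
  exact: dotmx_ge0.
by rewrite trmx_mul PT mulmxA -(mulmxA v P P) PP.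
Qed.

Lemma orth_proj_form_le n (P : 'M[R]_n) (v : 'rV_n) :
  orth_proj P -> (v *m P *m v^T) 0 0 <= (v *m v^T) 0 0.
Proof.
move/orth_projC/(orth_proj_form_ge0 v).
by rewrite mulmxBr mulmx1 mulmxBl !mxE subr_ge0.
Qed.

(** The rows of W are an orthonormal basis of the row space of P, built by induction on the rank:
    split off a unit vector w of that space and continue with P - w^T w. *)
Lemma orth_proj_isometry n (P : 'M[R]_n) : orth_proj P ->
  exists2 W : 'M[R]_(\rank P, n), W *m W^T = 1%:M & W^T *m W = P.
Proof.
move: {2}(\rank P) (erefl (\rank P)) => r rP oP; rewrite rP.
elim: r P rP oP => [|r IHr] P rP oP.
  exists 0; first by rewrite [LHS]flatmx0 [RHS]flatmx0.
  by move/eqP: rP; rewrite mxrank_eq0 mulmx0 => /eqP.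
have P0 : P != 0 by rewrite -mxrank_eq0 rP.
have [PT PP] := oP.
set v := nz_row P; have v0 : v != 0 by rewrite nz_row_eq0.
have vP : v *m P = v.
  by have /submxP[D ->] : (v <= P)%MS := nz_row_sub P; rewrite -mulmxA PP.
set q := (v *m v^T) 0 0; have q0 : 0 < q := dotmx_gt0 v0.
set w := (Num.sqrt q)^-1 *: v.
have ww : w *m w^T = 1%:M.
  rewrite /w linearZ /= -scalemxAl -scalemxAr scalerA [v *m _]mx11_scalar.
  rewrite -/q scale_scalar_mx -invfM -expr2 sqr_sqrtr ?ltW //.
  by rewrite mulVf // gt_eqF.
have wP : w *m P = w by rewrite /w -scalemxAl vP.
have Pw : P *m w^T = w^T by rewrite -{1}PT -trmx_mul wP.
have oP' : orth_proj (P - w^T *m w).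
  split; first by rewrite linearB /= PT trmx_mul trmxK.
  rewrite mulmxBl !mulmxBr PP mulmxA Pw -[_ *m w *m P]mulmxA wP.
  by rewrite -mulmxA [w *m (_ *m _)]mulmxA ww mul1mx subrr subr0.
have rP' : \rank (P - w^T *m w) = r.
  apply/eqP; rewrite -(eqr_nat R) orth_proj_rank // linearB /=.
  by rewrite -orth_proj_rank // rP mxtrace_mulC ww mxtrace1 mulrSr addrK.
have [W WW WP] := IHr _ rP' oP'.
(* Since W^T W = P - w^T w is killed by w on the left, w W^T = w W^T (W W^T) = 0. *)
have wW : w *m W^T = 0.
  have : w *m (P - w^T *m w) *m W^T = 0.
    by rewrite mulmxBr wP mulmxA ww mul1mx subrr mul0mx.
  by rewrite -WP mulmxA -mulmxA WW mulmx1.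
have Ww : W *m w^T = 0 by rewrite -[LHS]trmxK trmx_mul trmxK wW trmx0.
have CC : col_mx w W *m (col_mx w W)^T = 1%:M.
  by rewrite tr_col_mx mul_col_row ww wW Ww WW -scalar_mx_block.
have CP : (col_mx w W)^T *m col_mx w W = P.
  by rewrite tr_col_mx mul_row_col WP addrC subrK.
by exists (col_mx w W); [exact: CC | exact: CP].
Qed.

(** * Trace identity and Naimark complementation *)

Lemma TFF_sumn (a : R) N L : TFF a N L -> (sumn L)%:R = a * N%:R.
Proof.
case=> _ [_ [P [oP [rP sP]]]].
have := congr1 mxtrace sP; rewrite linear_sum mxtrace_scalar /= mulr_natr => <-.
rewrite sumnE (big_nth 0%N) big_mkord natr_sum.
by apply: eq_bigr => i _; rewrite -rP orth_proj_rank.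
Qed.

(* Conjugate scalings satisfy 1/a + 1/b = 1.  Factoring P_i = W_i^T W_i with
   W_i W_i^T = 1 and stacking the W_i into V, the matrix 1 - V V^T / a is an
   orthogonal projection U^T U of rank sum L - N; the column blocks U_i of U
   give the complementary frame b U_i U_i^T. *)
Lemma TFF_naimark (a b : R) N N' L :
  1 < a -> (a - 1) * (b - 1) = 1 -> N'%:R = (a - 1) * N%:R ->
  TFF a N L -> TFF b N' L.
Proof.
move=> a1 ab hN' tL; have sL := TFF_sumn tL.
case: tL => srt [pos [P [oP [rP sP]]]]; split=> //; split=> //.
have a0 : a != 0 by rewrite gt_eqF // (lt_trans ltr01).
have abE : b * (1 - a^-1) = 1.
  apply: (mulIf a0); rewrite mul1r -mulrA mulrBl mul1r mulVf //.
  move: ab; rewrite mulrBr mulr1 => /eqP; rewrite subr_eq mulrC => /eqP->.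
  by rewrite addrC subrK.
have [W WW WP] : exists2 W : forall i, 'M[R]_(\rank (P i), N),
    forall i, W i *m (W i)^T = 1%:M & forall i, (W i)^T *m W i = P i.
  have h i : {W : 'M[R]_(\rank (P i), N) | W *m W^T = 1%:M /\ W^T *m W = P i}.
    apply: boolp.cid; have [W] := orth_proj_isometry (oP i); by exists W.
  by exists (fun i => sval (h i)) => i; have [] := svalP (h i).
pose V := \mxcol_i W i.
have VV : V^T *m V = a%:M.
  by rewrite tr_mxcol mul_mxrow_mxcol -sP; apply: eq_bigr => i _.
pose Q := 1%:M - a^-1 *: (V *m V^T).
have oQ : orth_proj Q.
  apply: orth_projC; split; first by rewrite linearZ /= trmx_mul trmxK.
  rewrite -scalemxAl -scalemxAr mulmxA -[V *m _ *m V]mulmxA VV.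
  by rewrite mul_mx_scalar -scalemxAl [a^-1 *: (a *: _)]scalerA mulVf // scale1r.
have rQ : \rank Q = N'.
  apply/eqP; rewrite -(eqr_nat R) orth_proj_rank // linearB /= mxtraceZ.
  rewrite mxtrace_mulC VV mxtrace1 mxtrace_scalar mulrnAr mulVf //.
  rewrite hN' mulrBl mul1r -sL sumnE (big_nth 0%N) big_mkord.
  by under [in eqbRHS]eq_bigr do rewrite -rP.
have [U UU UQ] := orth_proj_isometry oQ.
(* U has [\rank Q] rows, so the matrices U_i U_i^T have the required size only once N' is replaced
   by this rank. *)
rewrite -{}rQ.
pose u i := submxrow U i.
(* U_i^T U_i is the i-th diagonal block of Q, and that of V V^T is W_i W_i^T = 1. As b (1 - 1/a) =
   1, the factor b makes U_i U_i^T idempotent. *)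
have uu i : (u i)^T *m u i = (1 - a^-1)%:M.
  rewrite /u tr_submxrow submxcol_mul mul_submxrow -submxblockEh.
  rewrite UQ /Q submxblockB -[1%:M]mxdiagZ submxblock_diag.
  have -> : submxblock (a^-1 *: (V *m V^T)) i i = a^-1 *: submxblock (V *m V^T) i i.
    by apply/matrixP => j k; rewrite !mxE.
  by rewrite tr_mxcol mul_mxcol_mxrow mxblockK WW scalemx1 raddfB.
have op i : orth_proj (b *: (u i *m (u i)^T)).
  split; first by rewrite linearZ /= trmx_mul trmxK.
  rewrite -scalemxAl -scalemxAr mulmxA -[u i *m _ *m u i]mulmxA uu.
  by rewrite mul_mx_scalar -scalemxAl [b *: (_%R *: (_ *m _))]scalerA abE scale1r.
exists (fun i => b *: (u i *m (u i)^T)); split=> //; split.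
  move=> i; apply/eqP; rewrite -(eqr_nat R) orth_proj_rank // mxtraceZ.
  by rewrite mxtrace_mulC uu mxtrace_scalar mulrnAr abE rP.
by rewrite -scaler_sumr -mul_mxrow_mxcol -tr_mxrow submxrowK UU scalemx1.
Qed.

(** The hypotheses are symmetric in (a, N) and (b, N'): they give b > 1 and N = (b - 1) N'. *)
Lemma TFF_naimark_iff (a b : R) N N' L :
  1 < a -> (a - 1) * (b - 1) = 1 -> N'%:R = (a - 1) * N%:R ->
  TFF a N L <-> TFF b N' L.
Proof.
move=> a1 ab hN'; split; first exact: TFF_naimark.
have b1 : 1 < b by rewrite -subr_gt0 -(pmulr_rgt0 _ (_ : 0 < a - 1)) ?subr_gt0 // ab.
apply: TFF_naimark => //; first by rewrite mulrC.
by rewrite hN' mulrA mulrC [_ * (a - 1)]mulrC ab mulr1.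
Qed.

(** * Bounds on the partial sums of the ranks *)

Lemma mxrank_sumr_le (F : fieldType) m n (I : finType) (p : pred I)
    (A : I -> 'M[F]_(m, n)) :
  (\rank (\sum_(i | p i) A i)%R <= \sum_(i | p i) \rank (A i))%N.
Proof.
apply: (big_ind2 (fun (B : 'M_(m, n)) r => (\rank B <= r)%N)) => [|B r C s hB hC|//].
  by rewrite mxrank0.
exact: leq_trans (mxrank_add B C) (leq_add hB hC).
Qed.

(** A row vector killed by A has zero quadratic form, so it vanishes. *)
Lemma posdef_rank n (A : 'M[R]_n) :
  (forall v : 'rV_n, v != 0 -> 0 < (v *m A *m v^T) 0 0) -> \rank A = n.
Proof.
move=> posA; apply/eqP; apply: inj_row_free => v vA.
by apply/eqP; apply: contraT => /posA; rewrite vA mul0mx mxE ltxx.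
Qed.

Lemma sumn_take L k : (k <= size L)%N ->
  sumn (take k L) = (\sum_(i < size L | i < k) nth 0 L i)%N.
Proof.
move=> hk; rewrite sumnE (big_nth 0%N) big_mkord size_takel //.
rewrite (big_ord_widen _ (fun i => nth 0%N (take k L) i) hk).
by apply: eq_bigr => i ik; rewrite nth_take.
Qed.

Lemma sum_form n (I : finType) (p : pred I) (A : I -> 'M[R]_n) (v : 'rV_n) :
  (v *m (\sum_(i | p i) A i) *m v^T) 0 0 = \sum_(i | p i) (v *m A i *m v^T) 0 0.
Proof. by rewrite mulmx_sumr mulmx_suml summxE. Qed.

Lemma scalar_form n (c : R) (v : 'rV_n) :
  (v *m c%:M *m v^T) 0 0 = c * (v *m v^T) 0 0.
Proof. by rewrite mul_mx_scalar -scalemxAl mxE. Qed.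

(* The projections beyond the k-th sum to an operator bounded below by a - k,
   so their ranks add up to at least N. *)
Lemma TFF_take_lt (a : R) N L k : TFF a N L -> (k <= size L)%N -> k%:R < a ->
  (sumn (take k L) + N <= sumn L)%N.
Proof.
move=> [_ [_ [P [oP [rP sP]]]]] hk ka.
have -> : sumn L = (\sum_(i < size L) nth 0 L i)%N.
  by rewrite sumnE (big_nth 0%N) big_mkord.
rewrite sumn_take // [leqRHS](bigID (fun i : 'I_(size L) => i < k)%N) /= leq_add2l.
rewrite -{1}[N](@posdef_rank N (\sum_(i < size L | ~~ (i < k)%N) P i)).
  apply: leq_trans (mxrank_sumr_le _ _) _.
  by rewrite (eq_bigr _ (fun i _ => rP i)).
move=> v v0; have vv := dotmx_gt0 v0.
have := scalar_form a v; rewrite -sP sum_form (bigID (fun i : 'I_(size L) => i < k)%N) /=.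
rewrite sum_form; have : k%:R * (v *m v^T) 0 0 < a * (v *m v^T) 0 0.
  by rewrite ltr_pM2r.
suff : \sum_(i < size L | (i < k)%N) (v *m P i *m v^T) 0 0 <= k%:R * (v *m v^T) 0 0.
  by lra.
apply: (@le_trans _ _ (\sum_(i < size L | (i < k)%N) (v *m v^T) 0 0)).
  by apply: ler_sum => i _; apply: orth_proj_form_le.
by rewrite -(big_ord_widen _ (fun=> (v *m v^T) 0 0) hk) sumr_const card_ord mulr_natl.
Qed.

(* The first k projections sum to at most a < k, so the ranks of their
   complements add up to at least N. *)
Lemma TFF_take_gt (a : R) N L k : TFF a N L -> (k <= size L)%N -> a < k%:R ->
  (sumn (take k L) + N <= k * N)%N.
Proof.
move=> [_ [_ [P [oP [rP sP]]]]] hk ka.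
have kNE : (k * N)%N = (\sum_(i < size L | i < k) N)%N.
  by rewrite -(big_ord_widen _ (fun=> N) hk) sum_nat_const card_ord.
rewrite kNE sumn_take //.
rewrite -{1}[N](@posdef_rank N (\sum_(i < size L | (i < k)%N) (1%:M - P i))).
  apply: leq_trans (leq_add (leqnn _) (mxrank_sumr_le _ _)) _.
  rewrite -big_split /=; apply: leq_sum => i _.
  by rewrite orth_proj_rankC // rP -rP subnKC // rank_leq_row.
move=> v v0; have vv := dotmx_gt0 v0.
have := scalar_form a v; rewrite -sP sum_form (bigID (fun i : 'I_(size L) => i < k)%N) /=.
have : 0 <= \sum_(i < size L | ~~ (i < k)%N) (v *m P i *m v^T) 0 0.
  by apply: sumr_ge0 => i _; apply: orth_proj_form_ge0.
have : a * (v *m v^T) 0 0 < k%:R * (v *m v^T) 0 0 by rewrite ltr_pM2r.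
move=> aw pos_tail total; rewrite sum_form.
rewrite (eq_bigr (fun i => (v *m v^T) 0 0 - (v *m P i *m v^T) 0 0)); last first.
  by move=> i _; rewrite mulmxBr mulmx1 mulmxBl !mxE.
rewrite sumrB -(big_ord_widen _ (fun=> (v *m v^T) 0 0) hk) sumr_const card_ord.
rewrite -[_ *+ k]mulr_natl; lra.
Qed.

Lemma TFF_mem_le (a : R) N L x : TFF a N L -> x \in L -> (x <= N)%N.
Proof.
move=> [_ [_ [P [oP [rP sP]]]]] /(nthP 0%N) [i iL <-].
by rewrite -(rP (Ordinal iL)) rank_leq_row.
Qed.

Lemma TFF_take_le (a : R) N L k : TFF a N L -> (k <= size L)%N ->
  (sumn (take k L) <= k * N)%N.
Proof.
move=> tL hk; rewrite sumnE big_seq -[k in leqRHS](size_takel hk) mulnC.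
rewrite -sum1_size big_distrr [leqRHS]big_seq /=; apply: leq_sum => x /mem_take xL.
by rewrite muln1 (TFF_mem_le tL xL).
Qed.

(** * Adjoining identity matrices to a frame *)

Lemma TFF_cons (a : R) N L : (0 < N)%N -> TFF a N L -> TFF (a + 1) N (N :: L).
Proof.
move=> N0 tL; have le_N x := @TFF_mem_le _ _ _ x tL.
case: tL => srt [pos [P [oP [rP sP]]]]; split.
  by case: L srt le_N {pos P oP rP sP} => //= y L -> ->; rewrite ?mem_head.
split; first by rewrite /= N0.
pose P' (i : 'I_(size L).+1) := if unlift ord0 i is Some j then P j else 1%:M.
exists P'; split.
  move=> i; rewrite /P'; case: unliftP => [j _|_]; first exact: oP.
  by split; rewrite ?trmx1 ?mulmx1.
split.
  move=> i; rewrite /P'; case: unliftP => [j ->|->]; first by rewrite rP.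
  by rewrite mxrank1.
rewrite big_ord_recl /P' unlift_none raddfD /= addrC; congr (_ + _).
by rewrite -sP; apply: eq_bigr => i _; rewrite liftK.
Qed.

Lemma TFF_cat_nseq (a : R) N L m : (0 < N)%N -> TFF a N L ->
  TFF (a + m%:R) N (nseq m N ++ L).
Proof.
move=> N0 tL; elim: m => [|m IHm] /=; first by rewrite addr0.
by rewrite -natr1 addrA; apply: TFF_cons.
Qed.

Lemma TFF_nseq N n : (0 < N)%N -> TFF n%:R N (nseq n N).
Proof.
move=> N0; rewrite -[n%:R]add0r -[nseq n N]cats0; apply: TFF_cat_nseq => //.
(* The start is the empty frame, of scaling 0; the constant family is a dummy on an empty index
   type. *)
do 2!split=> //; exists (fun=> 0); split; first by case.
by split; [case | rewrite big_ord0 raddf0].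
Qed.

(** * Greatest and maximal elements for majorization *)

(** Partial sums at k = 1 force equal heads, which are then dropped. Once one list is empty, equal
    totals and positivity force the other to be empty too. *)
Lemma majorized_anti L M :
  all (fun l : nat => (0 < l)%N) L -> all (fun l : nat => (0 < l)%N) M ->
  majorized L M -> majorized M L -> L = M.
Proof.
elim: L M => [|x L IHL] [|y M] //=.
- by move=> _ /andP[y0 _] [/= + _]; lia.
- by move=> /andP[x0 _] _ [/= + _]; lia.
move=> /andP[x0 L0] /andP[y0 M0] [/= sLM hLM] [_ hML].
have xy : x = y by have := hLM 1%N; have := hML 1%N; rewrite /= !take0 /=; lia.
subst y; congr (_ :: _); apply: IHL => //; split; try by lia.
- by move=> k hk; have := hLM k.+1; rewrite /=; lia.
- by move=> k hk; have := hML k.+1; rewrite /=; lia.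
Qed.

Lemma greatest_unique_maximal (S : seq nat -> Prop) L :
  (forall M, S M -> all (fun l : nat => (0 < l)%N) M) ->
  S L -> (forall M, S M -> majorized M L) -> unique_maximal S L.
Proof.
move=> pos SL le_L M; split=> [[SM maxM]|->].
  by rewrite (maxM _ SL (le_L _ SM)).
by split=> // M' SM' LM'; apply: majorized_anti; rewrite ?pos //; apply: le_L.
Qed.

Lemma unique_maximal_iff (S T : seq nat -> Prop) L :
  (forall M, S M <-> T M) -> unique_maximal S L -> unique_maximal T L.
Proof.
move=> ST hS M; rewrite -hS /maximal_elt ST.
by split=> -[? maxM]; split=> // M' /ST; apply: maxM.
Qed.

(** The trace identity makes all totals equal, so only partial sums remain to be compared. *)
Lemma TFF_greatest (a : R) N L : TFF a N L ->
  (forall M, TFF a N M -> forall k, (k <= minn (size M) (size L))%N ->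
    (sumn (take k M) <= sumn (take k L))%N) ->
  unique_maximal (TFF a N) L.
Proof.
move=> tL le_L; apply: greatest_unique_maximal => // M tM.
  by case: tM => _ [].
split; last exact: le_L.
by apply/eqP; rewrite -(eqr_nat R) !(TFF_sumn tL, TFF_sumn tM).
Qed.

(** * The four cases *)

Lemma TFF_nat_unique_maximal N n : (0 < N)%N ->
  unique_maximal (TFF n%:R N) (nseq n N).
Proof.
move=> N0; apply: TFF_greatest => [|M tM k]; first exact: TFF_nseq.
rewrite size_nseq leq_min => /andP[kM kn].
by rewrite take_nseq // sumn_nseq mulnC; apply: TFF_take_le tM kM.
Qed.

(** Case (3) with m = n - 1 and d = N/2, which avoids predecessors and divisions. *)
Lemma TFF_half_unique_maximal d m : (0 < d)%N ->
  unique_maximal (TFF (m.+1%:R + 2%:R^-1) (2 * d)) (nseq m (2 * d)%N ++ nseq 3 d).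
Proof.
move=> d0; have dd0 : (0 < 2 * d)%N by rewrite muln_gt0.
have tL : TFF (m.+1%:R + 2%:R^-1) (2 * d) (nseq m (2 * d)%N ++ nseq 3 d).
  (* The scalings 3/2 and 3 are conjugate and 2d = (3 - 1) d, so three identities in dimension d
     yield (d, d, d) in dimension 2d; the other m entries come from adjoined identities. *)
  have -> : m.+1%:R + 2%:R^-1 = 3%:R / 2%:R + m%:R :> R by rewrite -natr1; field.
  apply: TFF_cat_nseq => //; apply: TFF_naimark (TFF_nseq 3 d0).
  - by lra.
  - by field.
  - by rewrite natrM; ring.
apply: TFF_greatest => // M tM k.
have sM : sumn M = (m * (2 * d) + 3 * d)%N.
  apply/eqP; rewrite -(eqr_nat R) (TFF_sumn tM) natrD !natrM -natr1.
  by apply/eqP; field.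
rewrite size_cat !size_nseq leq_min => /andP[kM km].
(* Truncated subtraction makes the last term vanish for k <= m. *)
have sL : sumn (take k (nseq m (2 * d)%N ++ nseq 3 d)) =
    (minn k m * (2 * d) + (k - m) * d)%N.
  rewrite take_cat size_nseq; case: ltnP => mk.
    by rewrite take_nseq ?sumn_nseq; lia.
  by rewrite sumn_cat take_nseq ?sumn_nseq; lia.
rewrite sL; have [km0|mk] := leqP k m.
  by have := TFF_take_le tM kM; lia.
(* As m + 1 < a < m + 2, the two rank bounds give at most (2m + 3) d - 2d and (m + 2) 2d - 2d,
   exactly the values reached by the candidate; at k = m + 3 the candidate reaches the full
   total. *)
have [k1|[k2|k3]] : (k = m.+1 \/ k = m.+2 \/ k = m.+3)%N by lia.
- have : (k%:R : R) < m.+1%:R + 2%:R^-1 by rewrite k1; lra.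
  by move/(TFF_take_lt tM kM); rewrite sM; nia.
- have : m.+1%:R + 2%:R^-1 < (k%:R : R) by rewrite k2 -(natr1 m.+1); lra.
  by move/(TFF_take_gt tM kM); nia.
- have : (sumn (take k M) + sumn (drop k M))%N = sumn M.
    by rewrite -sumn_cat cat_take_drop.
  by rewrite sM; nia.
Qed.

Theorem theorem3p4 (N n : nat) (hN : (0 < N)%N) (hn : (0 < n)%N) :
  unique_maximal (TFF n%:R N) (nseq n N) /\
  ((n %| N)%N ->
     unique_maximal (TFF (1 + n%:R^-1) N) (nseq n.+1 (N %/ n)%N)) /\
  ((2 %| N)%N ->
     unique_maximal (TFF (n%:R + 2%:R^-1) N)
       (nseq n.-1 N ++ nseq 3 (N %/ 2)%N)) /\
  (((2 * n).-1 %| N)%N ->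
     unique_maximal (TFF (1 + 2%:R / (2 * n).-1%:R) N)
       (nseq n.-1 (2 * N %/ (2 * n).-1)%N ++ nseq 3 (N %/ (2 * n).-1)%N)).
Proof.
split; first exact: TFF_nat_unique_maximal.
split=> [/dvdnP[d NE]|]; [|split=> /dvdnP[d NE]]; have d0 : (0 < d)%N by nia.
- have n0 : n%:R != 0 :> R by rewrite pnatr_eq0 -lt0n.
  (* Case (2) is dual to case (1) with n + 1 identities in dimension d: the scaling conjugate to n +
     1 is 1 + 1/n, and N = n d. *)
  rewrite NE mulnK //; apply: unique_maximal_iff (TFF_nat_unique_maximal n.+1 d0).
  move=> M; apply: TFF_naimark_iff.
  + by rewrite ltr1n ltnS.
  + by rewrite -natr1; field.
  + by rewrite -natr1 natrM; ring.
- rewrite NE mulnK // mulnC -{1}(prednK hn); exact: TFF_half_unique_maximal.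
set q := (2 * n).-1; have qE : (q%:R : R) = 2%:R * n%:R - 1.
  by rewrite /q -natrM -[in RHS](@prednK (2 * n)) ?muln_gt0 // -natr1 addrK.
have n1 : 1 <= n%:R :> R by rewrite ler1n.
have q0 : (0 < q)%N by rewrite /q; lia.
rewrite NE mulnA !mulnK //.
(* Case (4) is dual to case (3) in dimension 2d: there a - 1 = n - 1/2 = q/2, so b - 1 = 2/q and N =
   (q/2)(2d) = d q. *)
apply: unique_maximal_iff (TFF_half_unique_maximal n.-1 d0).
move=> M; rewrite prednK //; apply: TFF_naimark_iff.
- by lra.
- have q1 : 2%:R * n%:R - 1 != 0 :> R by rewrite -qE pnatr_eq0 -lt0n.
  by rewrite qE; field.
- by rewrite -/q (natrM _ d q) (natrM _ 2 d) qE; field.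
Qed.
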